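(* Let $p_X$ and $d(x,\hat{x})$ define a rate-distortion problem on the finite reproduction alphabet $\hat{\mathcal{X}}$, $M:=|\hat{\mathcal{X}}|$. Let $\bm{r}\in\Delta[\hat{\mathcal{X}}]$ be a probability distribution on $\hat{\mathcal{X}}$, $\beta > 0$, and let $q(\hat{x}|x)=\frac{r(\hat{x})e^{-\beta d(x,\hat{x})}}{\sum_{\hat{x}'}r(\hat{x}')e^{-\beta d(x,\hat{x}')}}$ be the encoder it defines. Then, for any integer $\alpha_0>0$, $$\frac{\partial^{\alpha_0}}{\partial\beta^{\alpha_0}}(Id-BA_\beta)[\bm{r}](\hat{x})=-\sum_x p_X(x)\,q(\hat{x}|x)\,P_{\alpha_0}(\hat{x},x).$$ Assume further that $r(\hat{x})>0$ for every $\hat{x}$, and let $\bm{\alpha}=(\alpha_0,\bm{\alpha}_+)\in\mathbb{N}_0\times\mathbb{N}_0^{M}$ be a multi-index with $\bm{\alpha}_+\ne\bm{0}$. Then $$\frac{\partial^{|\bm{\alpha}|}}{\partial\beta^{\alpha_0}\partial\bm{r}^{\bm{\alpha}_+}}(Id-BA_\beta)[\bm{r}](\hat{x})=\delta_{\bm{\alpha},\bm{e}_{\hat{x}}}-(-1)^{|\bm{\alpha}_+|-1}(|\bm{\alpha}_+|-1)!\,\bm{\alpha}!\sum_x p_X(x)\Big(\prod_{i=1}^M\Big(\frac{q(\hat{x}_i|x)}{r(\hat{x}_i)}\Big)^{\alpha_i}\Big)\sum_{\bm{k}\in\mathbb{N}_0^M:\,|\bm{k}|=\alpha_0}\Big(\prod_{i:\,\hat{x}_i\neq\hat{x}}G(k_i,\alpha_i)_{(\hat{x}_i,x)}\Big)\cdot\Big[\alpha_{\hat{x}}\,G(k_{\hat{x}},\alpha_{\hat{x}})_{(\hat{x},x)}-|\bm{\alpha}_+|\,(1+\alpha_{\hat{x}})\,q(\hat{x}|x)\,G(k_{\hat{x}},1+\alpha_{\hat{x}})_{(\hat{x},x)}\Big],$$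 where for integers $k,a\ge0$, $G(k,a)=0$ if $a=0<k$, and otherwise $$G(k,a)_{(\hat{x},x)}:=\sum_{\substack{\bm{t}\in\mathbb{N}_0^k:\ |\bm{t}|\le a,\\ \sum_j j\,t_j=k}}\frac{1}{\bm{t}!\,(a-|\bm{t}|)!}\prod_{j=1}^k\Big(\frac{P_j(\hat{x},x)}{j!}\Big)^{t_j}.$$
   Context: Rate-distortion (RD) problem: finite source alphabet $\mathcal{X}$, finite reproduction alphabet $\hat{\mathcal{X}}=\{\hat{x}_1,\dots,\hat{x}_M\}$, a source distribution $p_X$ on $\mathcal{X}$, a distortion measure $d:\mathcal{X}\times\hat{\mathcal{X}}\to\mathbb{R}_{\ge0}$. The Blahut-Arimoto operator is $BA_\beta[\bm{r}](\hat{x}):=\sum_x p_X(x)\,q(\hat{x}|x)=r(\hat{x})\sum_x\frac{p_X(x)e^{-\beta d(x,\hat{x})}}{\sum_{\hat{x}'}r(\hat{x}')e^{-\beta d(x,\hat{x}')}}$. Partial derivatives are of this expression as a function of the $M+1$ independent real variables $\beta$ and $r(\hat{x}_1),\dots,r(\hat{x}_M)$. $Id$ is the identity on $\mathbb{R}^M$. Multi-index notation: $|\bm{\alpha}|=\sum_j\alpha_j$, $\bm{\alpha}!=\prod_j\alpha_j!$ (for $\bm{\alpha}=(\alpha_0,\alpha_1,\dots,\alpha_M)$, including $\alpha_0$), $\frac{\partial^{|\bm{\alpha}|}}{\partial\beta^{\alpha_0}\partial\bm{r}^{\bm{\alpha}_+}}=\frac{\partial^{\alpha_0}}{\partial\beta^{\alpha_0}}\prod_{j=1}^M\frac{\partial^{\alpha_j}}{\partial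 r(\hat{x}_j)^{\alpha_j}}$; $\alpha_{\hat{x}}$ denotes $\alpha_i$ for $\hat{x}=\hat{x}_i$ (similarly $k_{\hat{x}}$). $\delta_{\bm{\alpha},\bm{e}_{\hat{x}}}$ is $1$ if $\bm{\alpha}$ is the unit vector with a single $1$ at the $\hat{x}$ entry (so $\alpha_0=0$) and $0$ otherwise. $0^0=1$ and empty products are $1$. Polynomials $P_k$: on $\mathbb{R}[x_0,x_1,x_2,\dots]$ let $\bar{d}$ be the $\mathbb{R}$-linear derivation (Leibniz rule, zero on constants) with $\bar{d}x_0=0$ and $\bar{d}x_k=x_1x_k-x_{k+1}$ for $k>0$. Put $P_0:=1$ and $P_{k+1}:=(x_1-x_0)P_k+\bar{d}P_k$, so $P_k\in\mathbb{R}[x_0,\dots,x_k]$. Define $P_k(\hat{x},x)$ as the value of $P_k$ at $x_0:=d(x,\hat{x})$ and $x_j:=\sum_{\hat{x}'}q(\hat{x}'|x)\,d(x,\hat{x}')^j$ for $1\le j\le k$. *)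

(* Defs.v *)
From HB Require Import structures.
From mathcomp Require Import all_boot all_order all_algebra finmap.
From mathcomp.multinomials Require Import monalg.
From mathcomp Require Import all_classical all_reals all_analysis.

Set Implicit Arguments.
Unset Strict Implicit.
Unset Printing Implicit Defensive.

Import Order.TTheory GRing.Theory Num.Theory.
Import numFieldNormedType.Exports.

Local Open Scope classical_set_scope.
Local Open Scope ring_scope.

(* The polynomial ring R[x_0, x_1, x_2, ...]. *)
Notation npoly R := {malg R[{cmonom nat}]}.

Section PolynomialsP.
Context {R : comNzRingType}.

Definition var (i : nat) : npoly R := << ucm i >>.

Definition dbar_var (i : nat) : npoly R :=
  if i is 0%N then 0 else var 1 * var i - var i.+1.

Definition dbar_monom (m : {cmonom nat}) : npoly R :=
  \sum_(i <- finsupp (cmonom_val m))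
     << (m i)%:R *g divcm m (ucm i) >> * dbar_var i.

(* The derivation with prescribed values dbar_var on the variables:
   dbar p = \sum_i (dp/dx_i) * dbar_var i.  Lemmas dbarD, dbarZ, dbarC, dbarX0,
   dbarXS and dbarM below give the characteristic properties. *)
Definition dbar (p : npoly R) : npoly R :=
  \sum_(m <- msupp p) p@_m *: dbar_monom m.

Fixpoint Ppoly (k : nat) : npoly R :=
  if k is k'.+1 then (var 1 - var 0) * Ppoly k' + dbar (Ppoly k') else 1.

Definition npoly_eval (v : nat -> R) (p : npoly R) : R :=
  mmap idfun
    (fun m : {cmonom nat} => \prod_(i <- finsupp (cmonom_val m)) v i ^+ m i) p.

Lemma dbarEw (A : {fset {cmonom nat}}) (p : npoly R) :
  (msupp p `<=` A)%fset -> dbar p = \sum_(m <- A) p@_m *: dbar_monom m.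
Proof.
move=> le; rewrite /dbar (big_fset_incl _ le) //= => x xd /mcoeff_outdom ->.
by rewrite scale0r.
Qed.

Lemma dbarD : {morph dbar : p q / p + q}.
Proof.
move=> p q; pose A := (msupp p `|` msupp q)%fset.
rewrite (dbarEw (msuppD_le p q)) (@dbarEw A p) ?(@dbarEw A q) ?fsubsetUl
  ?fsubsetUr // -big_split /=; apply: eq_bigr => m _.
by rewrite mcoeffD scalerDl.
Qed.

Lemma dbarZ (c : R) : {morph dbar : p / c *: p}.
Proof.
move=> p; rewrite (dbarEw (msuppZ_le c p)) /dbar scaler_sumr.
by apply: eq_bigr => m _; rewrite mcoeffZ scalerA.
Qed.

HB.instance Definition _ :=
  GRing.isLinear.Build R (npoly R) (npoly R) *:%R dbar (fun c p q =>
    etrans (dbarD _ _) (congr1 (+%R^~ _) (dbarZ c p))).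

Lemma dbarU (c : R) (m : {cmonom nat}) : dbar << c *g m >> = c *: dbar_monom m.
Proof. by rewrite (dbarEw msuppU_le) big_seq_fset1 mcoeffUU. Qed.

Lemma dbarC (c : R) : dbar c%:MP = 0.
Proof. by rewrite dbarU /dbar_monom mdom1 big_seq_fset0 scaler0. Qed.

Lemma dbar_varE (i : nat) : dbar (var i) = dbar_var i.
Proof.
rewrite dbarU scale1r /dbar_monom mdomU big_seq_fset1 cmUU.
suff -> : divcm (ucm i) (ucm i) = mone by rewrite mul1r.
by apply/eqP/cmP => j; rewrite divcmE subnn cm1.
Qed.

Lemma dbarX0 : dbar (var 0) = 0.
Proof. exact: dbar_varE. Qed.

Lemma dbarXS (k : nat) :
  dbar (var k.+1) = var 1 * var k.+1 - var k.+2.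
Proof. exact: dbar_varE. Qed.

Lemma dbar_monomEw (A : {fset nat}) (m : {cmonom nat}) :
  (finsupp (cmonom_val m) `<=` A)%fset ->
  dbar_monom m = \sum_(i <- A) << (m i)%:R *g divcm m (ucm i) >> * dbar_var i.
Proof.
move=> le; rewrite /dbar_monom (big_fset_incl _ le) //= => i _.
by rewrite -cmE_eq0 => /eqP ->; rewrite monalgU0 mul0r.
Qed.

Let mulrDACA (S : comPzRingType) (b c x y d : S) :
  (b * y + x * c) * d = b * d * y + x * (c * d).
Proof. by rewrite mulrDl mulrAC mulrA. Qed.

Lemma dbar_monomM (m n : {cmonom nat}) :
  dbar_monom (mmul m n) = dbar_monom m * << n >> + << m >> * dbar_monom n.
Proof.
have dist (a b c x y d : npoly R) :
    a = b * y + x * c -> a * d = b * d * y + x * (c * d).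
  by move=> ->; exact: mulrDACA.
have UU c1 c2 (k l : {cmonom nat}) :
    << c1 *g k >> * << c2 *g l >> = << c1 * c2 *g mmul k l >> :> npoly R.
  exact: fgmulUU.
have lem : (finsupp (cmonom_val m) `<=` finsupp (cmonom_val (mmul m n)))%fset.
  by rewrite mdomD fsubsetUl.
have len : (finsupp (cmonom_val n) `<=` finsupp (cmonom_val (mmul m n)))%fset.
  by rewrite mdomD fsubsetUr.
rewrite (dbar_monomEw lem) (dbar_monomEw len) {1}/dbar_monom.
rewrite [X in _ = X + _]big_distrl.
rewrite [X in _ = _ + X]big_distrr.
rewrite -big_split.
apply: eq_bigr => i _.
apply: dist.
rewrite [X in _ = X + _]UU [X in _ = _ + X]UU [_ * 1]mulr1 [1 * _]mul1r.
have cmPU (a b : {cmonom nat}) : ((a i)%:R : R) != 0 ->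
    divcm (mmul a b) (ucm i) = mmul (divcm a (ucm i)) b.
  move=> ai0; apply/eqP/cmP => j; rewrite divcmE !cmM divcmE ucmE.
  case: eqVneq => [<-|_]; last by rewrite !subn0.
  by rewrite addnBAC // lt0n; apply: contraNneq ai0 => ->.
have -> : << (m i)%:R *g mmul (divcm m (ucm i)) n >>
    = << (m i)%:R *g divcm (mmul m n) (ucm i) >> :> npoly R.
  have [->|h] := eqVneq ((m i)%:R : R) 0; first by rewrite !monalgU0.
  by rewrite cmPU.
have -> : << (n i)%:R *g mmul m (divcm n (ucm i)) >>
    = << (n i)%:R *g divcm (mmul m n) (ucm i) >> :> npoly R.
  have [->|h] := eqVneq ((n i)%:R : R) 0; first by rewrite !monalgU0.
  by rewrite (mulmC m n) (cmPU _ _ h) (mulmC m).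
by rewrite -monalgUD -natrD cmM.
Qed.

Let leibniz_sum (S : pzRingType) (D : {additive S -> S}) (I J : Type)
    (r : seq I) (s : seq J) (F : I -> S) (G : J -> S) :
  (forall i j, D (F i * G j) = D (F i) * G j + F i * D (G j)) ->
  D ((\sum_(i <- r) F i) * (\sum_(j <- s) G j)) =
  D (\sum_(i <- r) F i) * (\sum_(j <- s) G j) +
  (\sum_(i <- r) F i) * D (\sum_(j <- s) G j).
Proof.
move=> H; rewrite mulr_suml !raddf_sum mulr_suml mulr_suml -big_split /=.
apply: eq_bigr => i _; rewrite mulr_sumr raddf_sum mulr_sumr mulr_sumr.
by rewrite -big_split /=; apply: eq_bigr.
Qed.

Let leibnizZ (S : comAlgType R) (c e : R) (u v du dv : S) :
  (c * e) *: (du * v + u * dv) = (c *: du) * (e *: v) + (c *: u) * (e *: dv).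
Proof. by rewrite -!scalerAl -!scalerAr !scalerA scalerDr. Qed.

Lemma dbarM (p q : npoly R) : dbar (p * q) = dbar p * q + p * dbar q.
Proof.
have UU c1 c2 (m n : {cmonom nat}) :
    << c1 *g m >> * << c2 *g n >> = << c1 * c2 *g (mmul m n) >> :> npoly R.
  exact: fgmulUU.
have US c (m : {cmonom nat}) : << c *g m >> = c *: << m >> :> npoly R.
  by rewrite -mul_malgC UU mulr1 mul1m.
have H m n : dbar (<< p@_m *g m >> * << q@_n *g n >>)
    = dbar << p@_m *g m >> * << q@_n *g n >>
      + << p@_m *g m >> * dbar << q@_n *g n >>.
  apply: etrans (congr1 dbar (UU _ _ _ _)) _.
  apply: etrans (dbarU _ _) _.
  apply: etrans (congr1 (GRing.scale _) (dbar_monomM m n)) _.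
  apply: etrans (leibnizZ _ _ _ _ _ _) _.
  exact: (congr2 +%R (congr2 *%R (esym (dbarU _ _)) (esym (US _ _)))
                     (congr2 *%R (esym (US _ _)) (esym (dbarU _ _)))).
have := @leibniz_sum (npoly R) dbar _ _ (msupp p) (msupp q) _ _ H.
by rewrite -!monalgE.
Qed.

End PolynomialsP.

Section RateDistortion.
Context {R : realType} {X : finType} {M : nat}.
Variables (pX : X -> R) (d : X -> 'I_M -> R).

Definition is_distribution (T : finType) (p : T -> R) : Prop :=
  (forall t, 0 <= p t) /\ \sum_t p t = 1.

(* [encoder b r i x] is q(i|x). *)
Definition encoder (b : R) (r : 'rV[R]_M) (i : 'I_M) (x : X) : R :=
  r ord0 i * expR (- (b * d x i)) /
  \sum_(j < M) r ord0 j * expR (- (b * d x j)).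

Definition BA (b : R) (r : 'rV[R]_M) : 'rV[R]_M :=
  \row_i \sum_x pX x * encoder b r i x.

(* (Id - BA_b)[r](i) as a function of the M+1 independent variables (b, r). *)
Definition Id_sub_BA (i : 'I_M) (z : R * 'rV[R]_M) : R :=
  (z.2 - BA z.1 z.2) ord0 i.

Definition Pval (b : R) (r : 'rV[R]_M) (i : 'I_M) (x : X) (k : nat) : R :=
  npoly_eval
    (fun j => if j is 0%N then d x i
              else \sum_(l < M) encoder b r l x * d x l ^+ j)
    (Ppoly k).

End RateDistortion.

(* G(k,a), given the values P j of the polynomials P_j.  The index j : 'I_k
   stands for the index j.+1 of the mathematical notation; the constraint
   |t| <= a makes it harmless to bound each t_j by a. *)
Definition G {R : realType} (P : nat -> R) (k a : nat) : R :=
  if (a == 0%N) && (0 < k)%N then 0 else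
  \sum_(t : {ffun 'I_k -> 'I_a.+1} |
         (\sum_(j < k) t j <= a)%N && (\sum_(j < k) j.+1 * t j == k)%N)
    ((\prod_(j < k) (t j)`!) * (a - \sum_(j < k) t j)`!)%N%:R^-1 *
    \prod_(j < k) (P j.+1 / (j.+1)`!%:R) ^+ t j.

Section IteratedPartialDerivatives.
Context {R : realType} {V : normedModType R}.

(* Iterated directional derivative along a list of directions, the head of the
   list being the outermost derivative. *)
Definition iter_derive (vs : seq V) (F : V -> R) : V -> R :=
  foldr (fun v g => 'D_v g) F vs.

(* 'D_v g has a junk value at points where g is not derivable along v; this
   predicate states that the iterated derivative exists at z in the usual
   sense: the inner ones exist near z and the outermost one exists at z. *)
Fixpoint iter_derivable (vs : seq V) (F : V -> R) (z : V) : Prop :=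
  if vs is v :: vs' then
    (\forall y \near z, iter_derivable vs' F y) /\
    derivable (iter_derive vs' F) z v
  else True.

End IteratedPartialDerivatives.

(* The directions of d^|alpha| / db^a0 dr^ap in the (b, r) space. *)
Definition directions {R : realType} {M : nat} (a0 : nat)
    (ap : {ffun 'I_M -> nat}) : seq (R * 'rV[R]_M) :=
  nseq a0 (1, 0) ++ flatten [seq nseq (ap j) (0, delta_mx ord0 j) | j : 'I_M].

(* Main.v *)
Require Import Defs.
From HB Require Import structures.
From mathcomp Require Import all_boot all_order all_algebra finmap ring.
From mathcomp.multinomials Require Import monalg.
From mathcomp Require Import all_classical all_reals all_analysis.

(** With u_j = e^(-b d(x,j)) / Z(x) one has q(j|x) = r_j u_j. Each derivative in r_j
    multiplies 1/Z^n by -n u_j, so the r-derivatives of q(i|x) are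
    monomials in the u_j, plus r_i times such monomials. For the b-derivatives, the
    derivation dbar is d/db on the moments x_k, whence d^k u_j / db^k = u_j P_k(j,x):
    the Taylor series of u_j in b is u_j E_j with E_j = sum_k P_k(j,x) h^k / k!. Taylor
    series multiply, the coefficient of h^k in E_j^a is a! G(k,a) by the multinomial
    theorem, and extracting the coefficient of h^a0 in the product over j
    yields the sum over multi-indices k. *)

Set Implicit Arguments.
Unset Strict Implicit.
Unset Printing Implicit Defensive.

Import Order.TTheory GRing.Theory Num.Theory.
Import numFieldNormedType.Exports.

Local Open Scope classical_set_scope.
Local Open Scope ring_scope.

(** * Coefficients of products and powers of truncated series *)

Lemma prod_seq_count (A : comNzRingType) (I : finType) (s : seq I) (f : I -> A) :
  \prod_(j <- s) f j = \prod_j f j ^+ count_mem j s.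
Proof.
elim: s => [|i s IHs]; first by rewrite big_nil big1.
rewrite big_cons IHs; under [RHS]eq_bigr do rewrite exprD.
rewrite big_split /=; congr (_ * _).
rewrite (bigD1 i)//= eqxx expr1 big1 ?mulr1// => j /negPf ji.
by rewrite eq_sym ji.
Qed.

(** Turns the binomial theorem into a Cauchy product of the divided powers [z ^+ k / k!]. *)
Lemma inv_fact_bin (F : numFieldType) (n m : nat) : (m <= n)%N ->
  n`!%:R^-1 * 'C(n, m)%:R = m`!%:R^-1 * (n - m)`!%:R^-1 :> F.
Proof.
have fact0 k : (k`!%:R : F) != 0 by rewrite pnatr_eq0 -lt0n fact_gt0.
move=> mn; rewrite -(bin_fact mn) !natrM !invfM mulrAC mulVf ?mul1r//.
by rewrite pnatr_eq0 -lt0n bin_gt0.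
Qed.

(** Coefficients of degree at most [N] of a product see only those of the factors, so series may be
    truncated freely. *)
Lemma coef_prod_congr (A : comNzRingType) (I : Type) (s : seq I) (N : nat)
    (p q : I -> {poly A}) :
  (forall i k, (k <= N)%N -> (p i)`_k = (q i)`_k) ->
  forall k, (k <= N)%N -> (\prod_(i <- s) p i)`_k = (\prod_(i <- s) q i)`_k.
Proof.
move=> pq; elim: s => [|i s IHs] k kN; first by rewrite !big_nil.
rewrite !big_cons !coefM; apply: eq_bigr => j _.
by rewrite pq ?IHs// (leq_trans _ kN)// ?leq_subr// -ltnS.
Qed.

Lemma coef_prod (A : comNzRingType) (I : finType) (N k : nat)
    (p : I -> {poly A}) :
  (k <= N)%N ->
  (\prod_i p i)`_k =
  \sum_(f : {ffun I -> 'I_N.+1} | (\sum_i f i == k)%N) \prod_i (p i)`_(f i).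
Proof.
move=> kN.
rewrite (@coef_prod_congr _ _ _ N p
  (fun i => \sum_(m < N.+1) (p i)`_m *: 'X^m))//; last first.
  by move=> i m mN; rewrite -poly_def coef_poly ltnS mN.
rewrite bigA_distr_bigA coef_sum /= [RHS]big_mkcond/=; apply: eq_bigr => f _.
under eq_bigr do rewrite -mul_polyC.
rewrite big_split/= -rmorph_prod prodrXr coefCM coefXn eq_sym.
by case: eqP; rewrite ?mulr1 ?mulr0.
Qed.

(* The multinomial theorem, as the coefficient of degree [m] in a product of
   truncated exponentials. *)
Lemma divpow_sum (F : numFieldType) (A : comAlgType F) (N : nat) (I : finType)
    (y : I -> A) (m : nat) : (m <= N)%N ->
  (m`!%:R^-1 : F) *: (\sum_i y i) ^+ m =
  \sum_(t : {ffun I -> 'I_N.+1} | (\sum_i t i == m)%N)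
    \prod_i (((t i)`!%:R^-1 : F) *: y i ^+ t i).
Proof.
move=> mN.
pose e (z : A) : {poly A} := \poly_(k < N.+1) ((k`!%:R^-1 : F) *: z ^+ k).
have eE z k : (k <= N)%N -> (e z)`_k = (k`!%:R^-1 : F) *: z ^+ k.
  by move=> kN; rewrite coef_poly ltnS kN.
have H (s : seq I) k : (k <= N)%N ->
    (\prod_(i <- s) e (y i))`_k = (k`!%:R^-1 : F) *: (\sum_(i <- s) y i) ^+ k.
  elim: s k => [|i s IHs] k kN.
    rewrite !big_nil coef1 expr0n; case: k {kN} => [|k] /=; last by rewrite scaler0.
    by rewrite invr1 scale1r.
  rewrite !big_cons coefM addrC exprDn scaler_sumr.
  apply: eq_bigr => j _.
  have jk : (j <= k)%N by rewrite -ltnS.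
  rewrite eE ?(leq_trans jk)// IHs ?(leq_trans (leq_subr _ _))//.
  rewrite -(scaler_nat _ (_ * _)) scalerA.
  by rewrite inv_fact_bin// mulrC -scalerAl -scalerAr scalerA mulrC.
rewrite -H// (coef_prod _ mN).
by apply: eq_bigr => t _; apply: eq_bigr => i _; rewrite eE// -ltnS.
Qed.

(** As [P 0 = 1], the series is 1 plus terms of positive degree. The binomial theorem expands its
    power by the number [m] of such terms, and the multinomial theorem expands the [m]-th power over
    the [t] with [|t| = m]. *)
Lemma coef_powG (R : realType) (P : nat -> R) (N a k : nat) : P 0%N = 1 ->
  (k <= N)%N ->
  ((\poly_(m < N.+1) (P m / m`!%:R)) ^+ a)`_k = a`!%:R * G P k a.
Proof.
move=> P0 kN.
pose c (j : nat) := P j.+1 / j.+1`!%:R.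
(* The shift to degree [j.+1] follows the indexing of [G]; terms of degree above [k] cannot
   contribute. *)
pose y (j : 'I_k) : {poly R} := c j *: 'X^(j.+1).
have -> : ((\poly_(m < N.+1) (P m / m`!%:R)) ^+ a)`_k =
    ((1 + \sum_(j < k) y j) ^+ a)`_k.
  have := @coef_prod_congr R _ (index_enum 'I_a) k
    (fun=> \poly_(m < N.+1) (P m / m`!%:R)) (fun=> 1 + \sum_(j < k) y j).
  rewrite !prodr_const !card_ord; apply=> // _ m mk.
  rewrite coef_poly ltnS (leq_trans mk kN) coefD coef1 coef_sum.
  case: m mk => [|m] mk.
    rewrite P0 divr1 big1 ?addr0// => j _; by rewrite coefZ coefXn mulr0.
  rewrite add0r (bigD1 (Ordinal mk))//= coefZ coefXn eqxx mulr1 big1 ?addr0//.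
  move=> j /eqP jm; rewrite coefZ coefXn eqSS; case: eqP => [mj|]; rewrite ?mulr0//.
  by case: jm; exact: val_inj.
rewrite exprDn coef_sum.
have key (m : 'I_a.+1) :
    (a`!%:R^-1 : R) *:
      ((1 ^+ (a - m) * (\sum_(j < k) y j) ^+ m) *+ 'C(a, m)) =
    \sum_(t : {ffun 'I_k -> 'I_a.+1} | (\sum_(j < k) t j == m)%N)
      (((\prod_(j < k) (t j)`!) * (a - \sum_(j < k) t j)`!)%N%:R^-1 *
        \prod_(j < k) c j ^+ t j) *: 'X^(\sum_(j < k) j.+1 * t j)%N.
  rewrite expr1n mul1r -(scaler_nat _ (_ ^+ _)) scalerA inv_fact_bin -1?ltnS//.
  rewrite mulrC -scalerA (@divpow_sum R _ a)-1?ltnS// scaler_sumr.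
  apply: eq_bigr => t /eqP tm.
  rewrite tm natrM invfM natr_prod.
  under eq_bigr => j _ do
    rewrite exprZn scalerA -exprM -mul_polyC.
  rewrite big_split/= -rmorph_prod prodrXr big_split/= prodfV mul_polyC scalerA.
  by rewrite mulrCA mulrA.
(* Splits the constraint [|t| <= a] of [G] according to the value [m] of [|t|]. *)
have pick (n : nat) (z : R) :
    \sum_(m < a.+1) (if n == m then z else 0) = if (n <= a)%N then z else 0.
  rewrite -big_mkcond; case: leqP => na.
    by rewrite (big_pred1 (Ordinal (na : (n < a.+1)%N)))// => m; rewrite eq_sym.
  by rewrite big_pred0// => m; rewrite gtn_eqF// (leq_ltn_trans _ na)// -ltnS.
have -> : G P k a =
  \sum_(t : {ffun 'I_k -> 'I_a.+1} |
         (\sum_(j < k) t j <= a)%N && (\sum_(j < k) j.+1 * t j == k)%N)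
    ((\prod_(j < k) (t j)`!) * (a - \sum_(j < k) t j)`!)%N%:R^-1 *
    \prod_(j < k) c j ^+ t j.
  (* In the special case [a = 0 < k] the sum is empty as well: every [t j] is 0, so the weighted sum
     cannot reach [k]. *)
  rewrite /G; case: ifP => // /andP[/eqP a0 k0]; rewrite big_pred0// => t.
  have t0 j : t j = 0%N :> nat.
    by apply/eqP; rewrite -leqn0 -[X in (_ <= X)%N]a0 -ltnS.
  rewrite [X in _ && (X == _)]big1 => [|j _]; last by rewrite t0 muln0.
  by rewrite (ltn_eqF k0) andbF.
rewrite [in RHS]big_mkcondr [in RHS]big_mkcond mulr_sumr /=.
under [RHS]eq_bigr => t _ do rewrite -pick.
rewrite -mulr_sumr exchange_big mulr_sumr /=; apply: eq_bigr => m _.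
have a0 : (a`!%:R : R) != 0 by rewrite pnatr_eq0 -lt0n fact_gt0.
rewrite -[1 ^+ _ * _ *+ _](scalerKV a0) key coefZ coef_sum; congr (_ * _).
rewrite [in LHS]big_mkcond /=; apply: eq_bigr => t _.
case: eqP => // _; rewrite coefZ coefXn eq_sym.
by case: eqP; rewrite ?mulr1 ?mulr0.
Qed.

(** * Evaluation as a ring morphism, and its interplay with [dbar] *)

Section Eval.
Context {R : comNzRingType}.
Variable v : nat -> R.

Definition monom_eval (m : {cmonom nat}) : R :=
  \prod_(i <- finsupp (cmonom_val m)) v i ^+ m i.

Lemma monom_evalEw (A : {fset nat}) (m : {cmonom nat}) :
  (finsupp (cmonom_val m) `<=` A)%fset ->
  monom_eval m = \prod_(i <- A) v i ^+ m i.
Proof.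
move=> le; rewrite /monom_eval (big_fset_incl _ le) //= => i _.
by rewrite -cmE_eq0 => /eqP ->; rewrite expr0.
Qed.

Lemma monom_eval_mmorphism : mmorphism monom_eval.
Proof.
split=> [m n|]; last by rewrite /monom_eval mdom1 big_seq_fset0.
have lem : (finsupp (cmonom_val m) `<=` finsupp (cmonom_val (mmul m n)))%fset.
  by rewrite mdomD fsubsetUl.
have len : (finsupp (cmonom_val n) `<=` finsupp (cmonom_val (mmul m n)))%fset.
  by rewrite mdomD fsubsetUr.
rewrite (monom_evalEw lem) (monom_evalEw len) -big_split /=.
by apply: eq_bigr => i _; rewrite cmM exprD.
Qed.

HB.instance Definition _ :=
  monalg.isMultiplicative.Build _ _ monom_eval monom_eval_mmorphism.

Lemma npoly_evalM : {morph npoly_eval v : p q / p * q}.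
Proof. exact: (rmorphM (mmap idfun monom_eval)). Qed.

Lemma npoly_evalD : {morph npoly_eval v : p q / p + q}.
Proof. exact: (raddfD (mmap idfun monom_eval)). Qed.

Lemma npoly_eval0 : npoly_eval v 0 = 0.
Proof. exact: (raddf0 (mmap idfun monom_eval)). Qed.

Lemma npoly_evalN : {morph npoly_eval v : p / - p}.
Proof. exact: (raddfN (mmap idfun monom_eval)). Qed.

Lemma npoly_evalC (c : R) : npoly_eval v c%:MP = c.
Proof. exact: (@mmapC _ _ _ idfun monom_eval). Qed.

Lemma npoly_eval_var (i : nat) : npoly_eval v (var i) = v i.
Proof.
rewrite /npoly_eval mmapU /= mul1r mdomU big_seq_fset1.
by rewrite cmUU expr1.
Qed.

Lemma npoly_eval_dbarD p q :
  npoly_eval v (dbar (p + q)) = npoly_eval v (dbar p) + npoly_eval v (dbar q).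
Proof. exact: etrans (congr1 _ (dbarD p q)) (npoly_evalD _ _). Qed.

Lemma npoly_eval_dbarM p q : npoly_eval v (dbar (p * q)) =
  npoly_eval v (dbar p) * npoly_eval v q + npoly_eval v p * npoly_eval v (dbar q).
Proof.
apply: etrans (congr1 _ (dbarM p q)) _; apply: etrans (npoly_evalD _ _) _.
exact: congr2 (npoly_evalM _ _) (npoly_evalM _ _).
Qed.

Lemma npoly_eval_PpolyS k : npoly_eval v (Ppoly k.+1) =
  (v 1%N - v 0%N) * npoly_eval v (Ppoly k) + npoly_eval v (dbar (Ppoly k)).
Proof.
apply: etrans (npoly_evalD _ _) (congr1 (+%R^~ _) _).
apply: etrans (npoly_evalM _ _) (congr1 ( *%R^~ _) _).
apply: etrans (npoly_evalD _ _) (congr2 +%R (npoly_eval_var _) _).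
exact: etrans (npoly_evalN _) (congr1 -%R (npoly_eval_var _)).
Qed.

Lemma npoly_eval_dbar_var0 : npoly_eval v (dbar_var 0) = 0.
Proof. exact: npoly_eval0. Qed.

Lemma npoly_eval_dbar_varS k :
  npoly_eval v (dbar_var k.+1) = v 1%N * v k.+1 - v k.+2.
Proof.
apply: etrans (npoly_evalD _ _) (congr2 +%R _ _).
  exact: etrans (npoly_evalM _ _) (congr2 *%R (npoly_eval_var _) (npoly_eval_var _)).
exact: etrans (npoly_evalN _) (congr1 -%R (npoly_eval_var _)).
Qed.

End Eval.

(* Induction on this predicate lets the Leibniz rule [dbarM] replace any computation
   with the monomials in the definition of [dbar]. *)
Inductive npoly_gen (R : comNzRingType) : {malg R[{cmonom nat}]} -> Prop :=
| Gen_const c : npoly_gen c%:MP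
| Gen_var i : npoly_gen (var i)
| Gen_add p q : npoly_gen p -> npoly_gen q -> npoly_gen (p + q)
| Gen_mul p q : npoly_gen p -> npoly_gen q -> npoly_gen (p * q).

Lemma npoly_gen0 (R : comNzRingType) : npoly_gen (0 : {malg R[{cmonom nat}]}).
Proof.
have <- : 0%:MP = 0 :> {malg R[{cmonom nat}]} by exact: monalgU0.
exact: Gen_const.
Qed.

Lemma npoly_gen_opp (R : comNzRingType) (p : {malg R[{cmonom nat}]}) :
  npoly_gen p -> npoly_gen (- p).
Proof.
move=> gp; have -> : - p = (-1)%:MP * p by rewrite mul_malgC scaleN1r.
by apply: Gen_mul => //; exact: Gen_const.
Qed.

Lemma npoly_gen_dbar (R : comNzRingType) (p : {malg R[{cmonom nat}]}) :
  npoly_gen p -> npoly_gen (dbar p).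
Proof.
elim=> {p} [c|i|p q gp gdp gq gdq|p q gp gdp gq gdq].
- by rewrite dbarC; exact: npoly_gen0.
- rewrite dbar_varE; case: i => [|i]; first exact: npoly_gen0.
  apply: Gen_add; first by apply: Gen_mul; exact: Gen_var.
  by apply: npoly_gen_opp; exact: Gen_var.
- by rewrite dbarD; exact: Gen_add.
- by rewrite dbarM; apply: Gen_add; exact: Gen_mul.
Qed.

Lemma npoly_gen_Ppoly (R : comNzRingType) (k : nat) :
  npoly_gen (Ppoly k : {malg R[{cmonom nat}]}).
Proof.
elim: k => [|k IHk] /=; first exact: (Gen_const 1).
apply: Gen_add; last exact: npoly_gen_dbar.
apply: Gen_mul => //; apply: Gen_add; first exact: Gen_var.
by apply: npoly_gen_opp; exact: Gen_var.
Qed.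

(** * Calculus rules for directional derivatives *)

Section PointwiseRules.
Context {R : realType} {V : normedModType R}.
Implicit Types (f g : V -> R) (z e : V).

Lemma is_derive_add f g z e df dg : is_derive z e f df -> is_derive z e g dg ->
  is_derive z e (fun y => f y + g y) (df + dg).
Proof. exact: is_deriveD. Qed.

Lemma is_derive_opp f z e df : is_derive z e f df ->
  is_derive z e (fun y => - f y) (- df).
Proof. exact: is_deriveN. Qed.

Lemma is_derive_mul f g z e df dg : is_derive z e f df -> is_derive z e g dg ->
  is_derive z e (fun y => f y * g y) (df * g z + f z * dg).
Proof.
move=> hf hg; apply: is_derive_eq (is_deriveM hf hg) _.
by rewrite addrC /GRing.scale/= mulrC.
Qed.

Lemma is_derive_cmul (c : R) f z e df : is_derive z e f df ->
  is_derive z e (fun y => c * f y) (c * df).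
Proof.
move=> hf; apply: is_derive_eq (is_derive_mul (is_derive_cst c _ _) hf) _.
by rewrite mul0r add0r.
Qed.

Lemma is_derive_mulc (c : R) f z e df : is_derive z e f df ->
  is_derive z e (fun y => f y * c) (df * c).
Proof.
by move=> ?; under eq_fun do rewrite mulrC; rewrite mulrC; exact: is_derive_cmul.
Qed.

Lemma is_derive_sumr (I : Type) (s : seq I) (P : pred I) (f : I -> V -> R) z e
    (df : I -> R) :
  (forall i, P i -> is_derive z e (f i) (df i)) ->
  is_derive z e (fun y => \sum_(i <- s | P i) f i y) (\sum_(i <- s | P i) df i).
Proof.
move=> fdf; elim: s => [|i s IHs].
  under eq_fun do rewrite big_nil; rewrite big_nil; exact: is_derive_cst.
under eq_fun do rewrite big_cons; rewrite big_cons.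
by case: ifPn => // Pi; apply: is_derive_add => //; exact: fdf.
Qed.

Lemma is_derive_inv f z e df : f z != 0 -> is_derive z e f df ->
  is_derive z e (fun y => (f y)^-1) (- (df / f z ^+ 2)).
Proof.
move=> fz [fd <-]; apply: DeriveDef; first exact: derivableV.
by rewrite (deriveV fz fd) /GRing.scale/= mulNr mulrC.
Qed.

(** The two difference quotients coincide; this gives access to the one-variable chain rule. *)
Lemma is_derive_lineP f z e df :
  is_derive z e f df <-> is_derive (0 : R) 1 (fun h : R => f (h *: e + z)) df.
Proof.
have E : (fun h : R => h^-1 *: ((f \o shift z) (h *: e) - f z)) =
    (fun h : R => h^-1 *: (((fun t : R => f (t *: e + z)) \o shift 0) (h *: 1) -
       f (0 *: e + z))).
  apply/funext => h /=; rewrite addr0 scale0r add0r.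
  by congr (_ *: (f (_ *: _ + _) - _)); rewrite [RHS]mulr1.
by split=> -[hd hv]; apply: DeriveDef; move: hd hv; rewrite /derivable /derive E.
Qed.

Lemma is_derive_expR_comp f z e df : is_derive z e f df ->
  is_derive z e (fun y => expR (f y)) (df * expR (f z)).
Proof.
move=> /is_derive_lineP fd; apply/is_derive_lineP.
have h := is_derive_expR (f (0 *: e + z)).
apply: is_derive_eq (@is_derive1_comp _ _ _ _ _ _ h fd) _.
by rewrite scale0r add0r /GRing.scale/= mulrC.
Qed.

End PointwiseRules.

(** Differentiation and [dbar] obey the same Leibniz rule, so agreement on the variables spreads to
    all generated polynomials. *)
Lemma is_derive_npoly_eval (R : realType) (V : normedModType R)
    (x : V -> nat -> R) (z e : V) :
  (forall j, is_derive z e (x^~ j) (npoly_eval (x z) (dbar_var j))) ->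
  forall p, npoly_gen p ->
  is_derive z e (fun y => npoly_eval (x y) p) (npoly_eval (x z) (dbar p)).
Proof.
move=> xd p; elim=> {p} [c|i|p q _ dp _ dq|p q _ dp _ dq].
- under eq_fun do rewrite npoly_evalC.
  by rewrite dbarC npoly_eval0; exact: is_derive_cst.
- under eq_fun do rewrite npoly_eval_var.
  by rewrite dbar_varE.
- under eq_fun do rewrite npoly_evalD.
  exact: is_derive_eq (is_derive_add dp dq) (esym (npoly_eval_dbarD _ _ _)).
- under eq_fun do rewrite npoly_evalM.
  exact: is_derive_eq (is_derive_mul dp dq) (esym (npoly_eval_dbarM _ _ _)).
Qed.

(** * Iterated derivatives on an open set, and Taylor polynomials *)

Section IteratedDerivatives.
Context {R : realType} {V : normedModType R}.
Variable U : set V.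
Hypothesis openU : open U.

Definition has_iter_derive (vs : seq V) (F H : V -> R) :=
  forall z, U z -> iter_derivable vs F z /\ iter_derive vs F z = H z.

(** Openness makes the formula [H] for the inner derivative valid near [z], so it may be
    differentiated in its place. *)
Lemma has_iter_derive_cons vs F H (H' : V -> R) e :
  has_iter_derive vs F H -> (forall z, U z -> is_derive z e H (H' z)) ->
  has_iter_derive (e :: vs) F H'.
Proof.
move=> FH HH' z Uz.
have nU : \forall y \near z, U y by exact: open_nbhs_nbhs.
have E : \forall y \near z, H y = iter_derive vs F y.
  by apply: filterS nU => y /FH[].
have [hd hv] := near_eq_is_derive E (HH' z Uz).
split => //=; split=> //.
by apply: filterS nU => y /FH[].
Qed.

(* [p z] stands for the Taylor polynomial at [z], in the direction [e], of the
   function [fun z => (p z)`_0]. *)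
Definition is_jet (e : V) (K : nat) (p : V -> {poly R}) :=
  forall z, U z -> forall k, (k < K)%N ->
    is_derive z e (fun y => (p y)`_k) ((p z)^`()`_k).

(** Differentiating coefficient [k] along [e] gives [k.+1] times the next one; these factors
    accumulate to the factorial. *)
Lemma has_iter_derive_jet e K (p : V -> {poly R}) vs F :
  has_iter_derive vs F (fun z => (p z)`_0) -> is_jet e K p ->
  forall k, (k <= K)%N ->
  has_iter_derive (nseq k e ++ vs) F (fun z => k`!%:R * (p z)`_k).
Proof.
move=> F0 jp; elim=> [|k IHk] kK.
  by move=> z Uz; rewrite mul1r; exact: F0.
apply: has_iter_derive_cons (IHk (ltnW kK)) _ => z Uz.
apply: is_derive_eq (is_derive_cmul _ (jp z Uz k kK)) _.
by rewrite coef_deriv mulrnAr -mulrnAl factS mulnC natrM mulr_natr.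
Qed.

Lemma is_jetC e K (c : V -> R) : (forall z, U z -> is_derive z e c 0) ->
  is_jet e K (fun z => (c z)%:P).
Proof.
move=> dc z Uz k _; rewrite derivC coef0.
under eq_fun do rewrite coefC.
case: k => [|k]; first exact: dc.
exact: is_derive_cst.
Qed.

Lemma is_jetD e K p q : is_jet e K p -> is_jet e K q ->
  is_jet e K (fun z => p z + q z).
Proof.
move=> jp jq z Uz k kK; rewrite derivD coefD.
under eq_fun do rewrite coefD.
by apply: is_derive_add; [exact: jp|exact: jq].
Qed.

(** The Leibniz rule along [e] matches the one for the formal derivative, and coefficient [k] of the
    Cauchy product involves only indices at most [k], hence below [K]. *)
Lemma is_jetM e K p q : is_jet e K p -> is_jet e K q ->
  is_jet e K (fun z => p z * q z).
Proof.
move=> jp jq z Uz k kK; rewrite derivM coefD !coefM -big_split /=.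
under eq_fun do rewrite coefM.
apply: is_derive_sumr => j _; apply: is_derive_mul.
  by apply: jp => //; rewrite (leq_ltn_trans _ kK)// -ltnS.
by apply: jq => //; rewrite (leq_ltn_trans _ kK)// leq_subr.
Qed.

Lemma is_jet_sum e K (I : Type) (s : seq I) (p : I -> V -> {poly R}) :
  (forall i, is_jet e K (p i)) -> is_jet e K (fun z => \sum_(i <- s) p i z).
Proof.
move=> jp; elim: s => [|i s IHs].
  under eq_fun do rewrite big_nil.
  by apply: is_jetC => z _; exact: is_derive_cst.
by under eq_fun do rewrite big_cons; exact: is_jetD.
Qed.

Lemma is_jet_prod e K (I : Type) (s : seq I) (p : I -> V -> {poly R}) :
  (forall i, is_jet e K (p i)) -> is_jet e K (fun z => \prod_(i <- s) p i z).
Proof.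
move=> jp; elim: s => [|i s IHs].
  under eq_fun do rewrite big_nil.
  by apply: is_jetC => z _; exact: is_derive_cst.
by under eq_fun do rewrite big_cons; exact: is_jetM.
Qed.

End IteratedDerivatives.

(** * The encoder and its first derivatives *)

Section BlahutArimoto.
Context {R : realType} {X : finType} {M : nat}.
Variables (pX : X -> R) (d : X -> 'I_M -> R).
Local Notation V := (R * 'rV[R]_M)%type.
Implicit Types (x : X) (i j : 'I_M) (z e : V) (s : seq 'I_M).

Definition weight x j z : R := expR (- (z.1 * d x j)).

Definition partition_fun x z : R := \sum_(j < M) z.2 ord0 j * weight x j z.

(* [q(j|x) / r_j], which makes sense also when [r_j = 0]. *)
Definition tilt x j z : R := weight x j z / partition_fun x z.

(* Iterated derivatives need the formulas on a whole neighbourhood, where [r] leaves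
   the simplex and may have negative entries. *)
Definition posZ : set V := [set z | forall x, 0 < partition_fun x z].

Lemma encoderE x j z : encoder d z.1 z.2 j x = z.2 ord0 j * tilt x j z.
Proof. by rewrite /encoder mulrA. Qed.

Lemma is_derive_fst z e : is_derive z e (fun y : V => y.1) e.1.
Proof.
apply/is_derive_lineP => /=.
apply: is_derive_eq
  (is_derive_add (is_derive_mul (is_derive_id _ _) (is_derive_cst _ _ _))
    (is_derive_cst _ _ _)) _.
by rewrite mulr0 !addr0 mul1r.
Qed.

Lemma is_derive_coord z e j : is_derive z e (fun y : V => y.2 ord0 j) (e.2 ord0 j).
Proof.
apply/is_derive_lineP => /=.
under eq_fun do rewrite !mxE.
apply: is_derive_eq
  (is_derive_add (is_derive_mul (is_derive_id _ _) (is_derive_cst _ _ _))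
    (is_derive_cst _ _ _)) _.
by rewrite mulr0 !addr0 mul1r.
Qed.

Lemma is_derive_weight x j z e :
  is_derive z e (weight x j) (- (e.1 * d x j) * weight x j z).
Proof.
apply: (@is_derive_expR_comp _ _ (fun y : V => - (y.1 * d x j))).
apply: is_derive_opp.
apply: is_derive_eq (is_derive_mul (is_derive_fst z e) (is_derive_cst _ _ _)) _.
by rewrite mulr0 addr0.
Qed.

(** The quotient rule in an arbitrary direction, to be specialized both to [b] and to the entries of
    [r]. *)
Lemma is_derive_tilt x j z e : posZ z ->
  is_derive z e (tilt x j) (tilt x j z * (- (e.1 * d x j) -
    \sum_l (e.2 ord0 l - e.1 * d x l * z.2 ord0 l) * tilt x l z)).
Proof.
move=> Uz; have Z0 : partition_fun x z != 0 by rewrite gt_eqF.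
have dZ : is_derive z e (partition_fun x)
    (\sum_l (e.2 ord0 l - e.1 * d x l * z.2 ord0 l) * weight x l z).
  apply: is_derive_sumr => l _.
  apply: is_derive_eq
    (is_derive_mul (is_derive_coord z e l) (is_derive_weight x l z e)) _.
  by rewrite mulrBl mulrA mulrN mulNr (mulrC (z.2 _ _)).
apply: is_derive_eq
  (is_derive_mul (is_derive_weight x j z e) (is_derive_inv Z0 dZ)) _.
have -> : \sum_l (e.2 ord0 l - e.1 * d x l * z.2 ord0 l) * tilt x l z =
    (\sum_l (e.2 ord0 l - e.1 * d x l * z.2 ord0 l) * weight x l z) /
      partition_fun x z.
  by rewrite mulr_suml; apply: eq_bigr => l _; rewrite mulrA.
by rewrite /tilt; field.
Qed.

(** Each partition function is continuous, and finiteness of [X] allows intersecting the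
    neighbourhoods. *)
Lemma open_posZ : open posZ.
Proof.
rewrite openE => z Uz; 
apply: (@filter_forall _ X (fun x y => 0 < partition_fun x y) (nbhs z)) => x.
suff cx : partition_fun x y @[y --> z] --> partition_fun x z.
  by move: cx => /cvgr_gt; apply; exact: Uz.
apply: cvg_big => [|j _]; first exact: add_continuous.
apply: cvgM.
  apply: (cvg_comp _ (fun u : 'rV[R]_M => u ord0 j)); first exact: cvg_snd.
  exact: coord_continuous.
have c1 : y.1 @[y --> z] --> z.1 by exact: cvg_fst.
have c2 : - (y.1 * d x j) @[y --> z] --> - (z.1 * d x j).
  by apply: cvgN; apply: cvgMr_tmp.
exact: (cvg_comp _ expR c2 (@continuous_expR _ _)).
Qed.

(** * Iterated derivatives in the entries of [r] *)

Local Notation bdir := ((1, 0) : V).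
Local Notation rdir j := ((0, delta_mx ord0 j) : V).

Lemma is_derive_tilt_r x j k z : posZ z ->
  is_derive z (rdir k) (tilt x j) (- (tilt x k z * tilt x j z)).
Proof.
move=> Uz; apply: is_derive_eq (is_derive_tilt _ _ _ Uz) _ => /=.
rewrite (bigD1 k)//= big1 => [|l /negPf lk]; last first.
  by rewrite !mxE eqxx lk /=; ring.
by rewrite !mxE !eqxx /=; ring.
Qed.

Lemma is_derive_prod_tilt_r x k s z : posZ z ->
  is_derive z (rdir k) (fun y => \prod_(j <- s) tilt x j y)
    (- ((size s)%:R * tilt x k z * \prod_(j <- s) tilt x j z)).
Proof.
move=> Uz; elim: s => [|j s IHs].
  under eq_fun do rewrite big_nil.
  by rewrite !mul0r oppr0; exact: is_derive_cst.
under eq_fun do rewrite big_cons.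
apply: is_derive_eq (is_derive_mul (is_derive_tilt_r x j k Uz) IHs) _.
by rewrite /= big_cons -natr1; ring.
Qed.

(* The [s]-th partial derivative of [r_i e^(-b d(x,i)) / Z] with respect to the
   entries of [r]; each of them multiplies [1 / Z^n] by [- n e^(-b d(x,j)) / Z]. *)
Definition encoder_dr i s x z : R :=
  (-1) ^+ size s * (size s)`!%:R * z.2 ord0 i *
    (tilt x i z * \prod_(j <- s) tilt x j z) +
  (count_mem i s)%:R * ((-1) ^+ (size s).-1 * (size s).-1`!%:R) *
    \prod_(j <- s) tilt x j z.

(** Differentiating the tilts raises the order of both terms; differentiating the factor [r_i],
    which matters only for [k = i], feeds the first term into the second and increments the count of
    [i]. *)
Lemma is_derive_encoder_dr i k s x z : posZ z ->
  is_derive z (rdir k) (encoder_dr i s x) (encoder_dr i (k :: s) x z).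
Proof.
move=> Uz; rewrite /encoder_dr.
have dP := is_derive_prod_tilt_r x k s Uz.
have dR := is_derive_tilt_r x i k Uz.
apply: is_derive_eq (is_derive_add
  (is_derive_mul (is_derive_cmul _ (is_derive_coord z (rdir k) i))
     (is_derive_mul dR dP))
  (is_derive_cmul _ dP)) _.
rewrite /= big_cons mxE eqxx /= (eq_sym i k).
(* Under the Kronecker delta, [tilt x i] becomes the new factor [tilt x k] of the product over
   [k :: s]. *)
have ki : (k == i)%:R * tilt x i z = (k == i)%:R * tilt x k z.
  by case: eqP => [->|_] //; rewrite !mul0r.
rewrite (mulrA (_ * (k == i)%:R)) -(mulrA _ (k == i)%:R) ki.
(* The empty list is separate because the predecessor of its size is truncated at 0; its second term
   vanishes since the count is 0. *)
case: s {dP dR} => [|l s] /=.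
  by rewrite !big_nil !expr0 expr1 fact0 factS fact0 addn0 muln1; ring.
set P := \prod_(_ <- _) _; set c := (_ + count_mem i s)%N.
by rewrite natrD !factS !exprS !natrM; ring.
Qed.

(** The indicators encode the derivatives of the identity part: [r_i] itself, then 1 along [i], and
    0 in all other cases. *)
Definition Id_sub_BA_dr i s z : R :=
  (s == [::])%:R * z.2 ord0 i + (s == [:: i])%:R -
  \sum_x pX x * encoder_dr i s x z.

Lemma Id_sub_BAE i z : Id_sub_BA pX d i z = Id_sub_BA_dr i [::] z.
Proof.
rewrite /Id_sub_BA /Id_sub_BA_dr !mxE /= mul1r addr0; congr (_ - _).
apply: eq_bigr => x _; rewrite encoderE /encoder_dr /= big_nil; congr (_ * _).
by rewrite expr0 fact0 !mul0r addr0; ring.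
Qed.

Lemma is_derive_Id_sub_BA_dr i k s z : posZ z ->
  is_derive z (rdir k) (Id_sub_BA_dr i s) (Id_sub_BA_dr i (k :: s) z).
Proof.
move=> Uz.
have dS : is_derive z (rdir k) (fun y => \sum_x pX x * encoder_dr i s x y)
    (\sum_x pX x * encoder_dr i (k :: s) x z).
  apply: is_derive_sumr => x _.
  exact: is_derive_cmul (is_derive_encoder_dr i k s x Uz).
apply: is_derive_eq (is_derive_add (is_derive_add
  (is_derive_cmul _ (is_derive_coord z (rdir k) i)) (is_derive_cst _ _ _))
  (is_derive_opp dS)) _.
rewrite /Id_sub_BA_dr /= addr0 mul0r add0r mxE eqxx /= eqseq_cons (eq_sym i k).
by rewrite -natrM mulnb andbC.
Qed.

Lemma has_iter_derive_r i s :
  has_iter_derive posZ [seq rdir j | j <- s] (Id_sub_BA pX d i) (Id_sub_BA_dr i s).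
Proof.
elim: s => [|k s IHs] /=; first by move=> z _; rewrite -Id_sub_BAE.
apply: has_iter_derive_cons IHs _; first exact: open_posZ.
by move=> z; exact: is_derive_Id_sub_BA_dr.
Qed.

(** * Derivatives in [b]: the moments and the polynomials [P_k] *)

Lemma is_derive_coord_b i z : is_derive z bdir (fun y : V => y.2 ord0 i) 0.
Proof. by apply: is_derive_eq (is_derive_coord z bdir i) _; rewrite mxE. Qed.

Lemma is_derive_tilt_b x j z : posZ z ->
  is_derive z bdir (tilt x j)
    (tilt x j z * (\sum_l encoder d z.1 z.2 l x * d x l ^+ 1 - d x j)).
Proof.
move=> Uz; apply: is_derive_eq (is_derive_tilt _ _ _ Uz) _ => /=.
congr (_ * _); rewrite mul1r addrC; congr (_ - _).
rewrite -sumrN; apply: eq_bigr => l _; rewrite mxE encoderE.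
by rewrite expr1; ring.
Qed.

(** The moments satisfy [x_k' = x_1 x_k - x_(k+1)], so the derivative is the value of
    [dbar (Ppoly k)]; the recursion for [Ppoly k.+1] is then solved for it. *)
Lemma is_derive_Pval x j z k : posZ z ->
  is_derive z bdir (fun y : V => Pval d y.1 y.2 j x k)
    (Pval d z.1 z.2 j x k.+1 -
     (\sum_l encoder d z.1 z.2 l x * d x l ^+ 1 - d x j) * Pval d z.1 z.2 j x k).
Proof.
move=> Uz.
pose v (y : V) (k : nat) := if k is 0%N then d x j
  else \sum_(l < M) encoder d y.1 y.2 l x * d x l ^+ k.
have dv m : is_derive z bdir (v^~ m) (npoly_eval (v z) (dbar_var m)).
  case: m => [|m]; first by rewrite npoly_eval_dbar_var0; exact: is_derive_cst.
  rewrite npoly_eval_dbar_varS /v mulr_sumr -sumrB.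
  apply: is_derive_sumr => l _; under eq_fun do rewrite encoderE.
  apply: is_derive_eq (is_derive_mulc _
    (is_derive_mul (is_derive_coord_b l z) (is_derive_tilt_b x l Uz))) _.
  by rewrite mul0r add0r encoderE (exprS _ m.+1); ring.
apply: is_derive_eq (is_derive_npoly_eval dv (npoly_gen_Ppoly _ k)) _.
have -> : Pval d z.1 z.2 j x k.+1 =
    (\sum_l encoder d z.1 z.2 l x * d x l ^+ 1 - d x j) * Pval d z.1 z.2 j x k +
    npoly_eval (v z) (dbar (Ppoly k)).
  exact: npoly_eval_PpolyS.
by rewrite addrC addKr.
Qed.

(** * Taylor polynomials in [b] of the [r]-derivatives *)

Definition tilt_jet (K : nat) x j z : {poly R} :=
  \poly_(m < K.+1) (tilt x j z * (Pval d z.1 z.2 j x m / m`!%:R)).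

(** With [u] the tilt, [u' = u (x_1 - x_0)] cancels the correction in the derivative of [P_k],
    leaving [(u P_k)' = u P_(k+1)]. *)
Lemma is_jet_tilt K x j : is_jet posZ bdir K (tilt_jet K x j).
Proof.
move=> z Uz k kK.
have kf : (k`!%:R : R) != 0 by rewrite pnatr_eq0 -lt0n fact_gt0.
have k1 : (k.+1%:R : R) != 0 by rewrite pnatr_eq0.
under eq_fun do rewrite coef_poly ltnS (ltnW kK).
apply: is_derive_eq (is_derive_mul (is_derive_tilt_b x j Uz)
  (is_derive_mulc _ (is_derive_Pval x j k Uz))) _.
rewrite coef_deriv coef_poly !ltnS kK factS natrM -mulr_natr.
by field; rewrite kf nat1r k1.
Qed.

(** The formula of [encoder_dr] with each tilt replaced by its Taylor polynomial; [r_i] stays a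
    constant, being independent of [b]. *)
Definition encoder_jet K i s x z : {poly R} :=
  ((-1) ^+ size s * (size s)`!%:R * z.2 ord0 i)%:P *
    (tilt_jet K x i z * \prod_(j <- s) tilt_jet K x j z) +
  ((count_mem i s)%:R * ((-1) ^+ (size s).-1 * (size s).-1`!%:R))%:P *
    \prod_(j <- s) tilt_jet K x j z.

Definition Id_sub_BA_jet K i s z : {poly R} :=
  ((s == [::])%:R * z.2 ord0 i + (s == [:: i])%:R)%:P +
  \sum_x (- pX x)%:P * encoder_jet K i s x z.

Lemma tilt_jetE K x j z : tilt_jet K x j z =
  (tilt x j z)%:P * \poly_(m < K.+1) (Pval d z.1 z.2 j x m / m`!%:R).
Proof.
apply/polyP => m; rewrite coefCM !coef_poly.
by case: ltnP; rewrite ?mulr0.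
Qed.

Lemma Pval0 x j z : Pval d z.1 z.2 j x 0 = 1.
Proof. exact: npoly_evalC. Qed.

Lemma coef0_tilt_jet K x j z : (tilt_jet K x j z)`_0 = tilt x j z.
Proof. by rewrite coef_poly /= Pval0 fact0 divr1 mulr1. Qed.

Lemma coef0_Id_sub_BA_jet K i s z :
  (Id_sub_BA_jet K i s z)`_0 = Id_sub_BA_dr i s z.
Proof.
have hP x : (\prod_(j <- s) tilt_jet K x j z)`_0 = \prod_(j <- s) tilt x j z.
  by rewrite coef0_prod; apply: eq_bigr => j _; rewrite coef0_tilt_jet.
rewrite coefD coefC /= coef_sum /Id_sub_BA_dr -sumrN; congr (_ + _).
apply: eq_bigr => x _; rewrite coefCM mulNr; congr (- (_ * _)).
rewrite coefD !coefCM coefM big_ord_recl big_ord0 addr0 /= coef0_tilt_jet.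
by rewrite subnn hP.
Qed.

Lemma is_jet_Id_sub_BA K i s : is_jet posZ bdir K (Id_sub_BA_jet K i s).
Proof.
have jP x : is_jet posZ bdir K (fun z => \prod_(j <- s) tilt_jet K x j z).
  by apply: is_jet_prod => j; exact: is_jet_tilt.
apply: is_jetD.
  apply: is_jetC => z _.
  apply: is_derive_eq (is_derive_add (is_derive_cmul _ (is_derive_coord_b i z))
    (is_derive_cst _ _ _)) _.
  by rewrite mulr0 addr0.
apply: is_jet_sum => x; apply: is_jetM.
  by apply: is_jetC => z _; exact: is_derive_cst.
apply: is_jetD; apply: is_jetM => //.
- apply: is_jetC => z _.
  apply: is_derive_eq (is_derive_cmul _ (is_derive_coord_b i z)) _.
  by rewrite mulr0.
- by apply: is_jetM => //; exact: is_jet_tilt.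
- by apply: is_jetC => z _; exact: is_derive_cst.
Qed.

Lemma has_iter_derive_Id_sub_BA K i s :
  has_iter_derive posZ (nseq K bdir ++ [seq rdir j | j <- s]) (Id_sub_BA pX d i)
    (fun z => K`!%:R * (Id_sub_BA_jet K i s z)`_K).
Proof.
apply: has_iter_derive_jet (leqnn K); first exact: open_posZ.
  move=> z Uz; rewrite coef0_Id_sub_BA_jet.
  exact: has_iter_derive_r.
exact: is_jet_Id_sub_BA.
Qed.

(** * Extraction of the coefficients as sums over multi-indices *)

Lemma coef_prod_tilt_jet K x s z :
  (\prod_(j <- s) tilt_jet K x j z)`_K =
  (\prod_j tilt x j z ^+ count_mem j s) *
  \sum_(k : {ffun 'I_M -> 'I_K.+1} | (\sum_j k j == K)%N)
    \prod_j ((count_mem j s)`!%:R * G (Pval d z.1 z.2 j x) (k j) (count_mem j s)).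
Proof.
under eq_bigr do rewrite tilt_jetE.
rewrite big_split /= -rmorph_prod coefCM prod_seq_count; congr (_ * _).
rewrite prod_seq_count (coef_prod _ (leqnn K)); apply: eq_bigr => k _.
by apply: eq_bigr => j _; rewrite coef_powG ?Pval0// -ltnS.
Qed.

(** The two terms are products over [i :: s] and [s], which differ only in the multiplicity of [i].
    Factoring out the common factorials leaves [1 + ap i] and [size s] on the first, whose extra
    tilt joins [r_i] to form the encoder. *)
Lemma coef_encoder_jet K i s x z (ap : 'I_M -> nat) :
  (0 < size s)%N -> (forall j, count_mem j s = ap j) ->
  (encoder_jet K i s x z)`_K =
  (-1) ^+ (size s).-1 * (size s).-1`!%:R * (\prod_j (ap j)`!)%N%:R *
  ((\prod_j tilt x j z ^+ ap j) *
   \sum_(k : {ffun 'I_M -> 'I_K.+1} | (\sum_j k j == K)%N)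
     (\prod_(j | j != i) G (Pval d z.1 z.2 j x) (k j) (ap j)) *
     ((ap i)%:R * G (Pval d z.1 z.2 i x) (k i) (ap i) -
      (size s)%:R * (1 + ap i)%:R * encoder d z.1 z.2 i x *
      G (Pval d z.1 z.2 i x) (k i) (1 + ap i))).
Proof.
move=> s0 cnt; have -> : ap = (fun j => count_mem j s) by apply/funext.
rewrite /encoder_jet coefD !coefCM.
rewrite -(big_cons _ _ i s xpredT (fun j => tilt_jet K x j z)).
rewrite !coef_prod_tilt_jet.
have -> : \prod_j tilt x j z ^+ count_mem j (i :: s) =
    tilt x i z * \prod_j tilt x j z ^+ count_mem j s.
  by rewrite -!prod_seq_count big_cons.
rewrite !mulr_sumr -big_split /=; apply: eq_bigr => k _.
rewrite !(bigD1 (P := xpredT) i)//= eqxx.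
have -> : \prod_(j | j != i) (((i == j) + count_mem j s)`!%:R *
      G (Pval d z.1 z.2 j x) (k j) ((i == j) + count_mem j s)) =
    \prod_(j | j != i) ((count_mem j s)`!%:R *
      G (Pval d z.1 z.2 j x) (k j) (count_mem j s)).
  by apply: eq_bigr => j /negPf ji; rewrite eq_sym ji.
rewrite !big_split /= -natr_prod natrM natr_prod.
(* Positive size makes the predecessor genuine, so that [n.+1! = n.+1 * n!] applies. *)
case: (size s) s0 => // n _ /=.
rewrite encoderE add1n !factS exprS !natrM.
ring.
Qed.

Lemma directionsE a0 (ap : {ffun 'I_M -> nat}) : exists s,
  [/\ directions a0 ap = nseq a0 bdir ++ [seq rdir j | j <- s],
      forall j, count_mem j s = ap j & size s = (\sum_j ap j)%N].
Proof.
exists (flatten [seq nseq (ap j) j | j <- enum 'I_M]); split.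
- congr (_ ++ _); rewrite map_flatten -map_comp; congr flatten.
  by apply: eq_map => j /=; rewrite map_nseq.
- move=> j; rewrite count_flatten -map_comp sumnE big_map big_enum /=.
  rewrite (bigD1 j)//= count_nseq /= eqxx mul1n big1 ?addn0// => l /negPf lj.
  by rewrite count_nseq /= lj.
- rewrite size_flatten /shape -map_comp sumnE big_map big_enum /=.
  by apply: eq_bigr => j _; rewrite size_nseq.
Qed.

End BlahutArimoto.

(** * Assembly of the two derivative formulas *)

Unset Implicit Arguments.

Theorem theorem4 (R : realType) (X : finType) (M : nat)
    (pX : X -> R) (d : X -> 'I_M -> R) (r : 'rV[R]_M) (b : R)
    (pX_distr : is_distribution pX)
    (d_ge0 : forall x i, 0 <= d x i)
    (r_distr : is_distribution (fun i => r ord0 i))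
    (b_gt0 : 0 < b) :
  (forall (a0 : nat) (i : 'I_M), (0 < a0)%N ->
     let D := directions a0 [ffun=> 0%N] in
     iter_derivable D (Id_sub_BA pX d i) (b, r) /\
     iter_derive D (Id_sub_BA pX d i) (b, r) =
       - \sum_x pX x * encoder d b r i x * Pval d b r i x a0)
  /\
  ((forall i, 0 < r ord0 i) ->
   forall (a0 : nat) (ap : {ffun 'I_M -> nat}) (i : 'I_M),
     ap != [ffun=> 0%N] ->
     let D := directions a0 ap in
     let n := (\sum_j ap j)%N in
     let q := encoder d b r in
     let GG (k a : nat) (l : 'I_M) (x : X) := G (Pval d b r l x) k a in
     iter_derivable D (Id_sub_BA pX d i) (b, r) /\
     iter_derive D (Id_sub_BA pX d i) (b, r) =
       ((a0 == 0%N) && (ap == [ffun j => (j == i : nat)]))%:R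
       - (-1) ^+ (n - 1) * (n - 1)`!%:R * (a0`! * \prod_j (ap j)`!)%N%:R *
         \sum_x pX x * (\prod_j (q j x / r ord0 j) ^+ ap j) *
           \sum_(k : {ffun 'I_M -> 'I_a0.+1} | (\sum_j k j == a0)%N)
             (\prod_(j | j != i) GG (k j) (ap j) j x) *
             ((ap i)%:R * GG (k i) (ap i) i x
              - n%:R * (1 + ap i)%:R * q i x * GG (k i) (1 + ap i)%N i x)).
Proof.
have [r_ge0 r_sum] := r_distr.
(* A vanishing partition function would force every entry of [r] to 0, against total mass 1; zero
   entries of [r] are thus allowed. *)
have Uz : posZ d (b, r).
  move=> x; rewrite lt_neqAle sumr_ge0 ?andbT => [|j _]; last first.
    by rewrite mulr_ge0// expR_ge0.
  apply/eqP => Z0.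
  have r0 j : r ord0 j = 0.
    have /psumr_eq0P : \sum_j r ord0 j * weight d x j (b, r) = 0 by [].
    move=> /(_ (fun j _ => mulr_ge0 (r_ge0 j) (expR_ge0 _))) /(_ j isT) /eqP.
    by rewrite mulf_eq0 (gt_eqF (expR_gt0 _)) orbF => /eqP.
  have := r_sum; under eq_bigr do rewrite r0.
  by rewrite big1_eq => /esym/eqP; rewrite oner_eq0.
split=> [a0 i a0_gt0|r_gt0 a0 ap i ap0] /=.
  have [s [-> cnt sz]] := @directionsE R M a0 [ffun=> 0%N].
  have {sz} : size s = 0%N by rewrite sz big1// => j _; rewrite ffunE.
  case: s cnt => // _ _.
  have [Hd ->] := has_iter_derive_Id_sub_BA pX a0 i [::] Uz.
  split=> //.
  have fa : (a0`!%:R : R) != 0 by rewrite pnatr_eq0 -lt0n fact_gt0.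
  (* The identity part is constant in [b], so it has no coefficient of degree [a0 > 0]. *)
  rewrite coefD coefC gtn_eqF// add0r coef_sum mulr_sumr -sumrN.
  apply: eq_bigr => x _; rewrite coefCM coefD coefCM big_nil mulr1.
  rewrite mul0r polyC0 mul0r coef0 addr0 coef_poly leqnn (encoderE d x i (b, r)) /=.
  by rewrite expr0 fact0; field.
have [s [-> cnt sz]] := @directionsE R M a0 ap.
have s_gt0 : (0 < size s)%N.
  rewrite sz lt0n sum_nat_eq0; apply: contra ap0 => /forallP ap0.
  by apply/eqP/ffunP => j; rewrite ffunE; apply/eqP; exact: ap0.
have [Hd ->] := has_iter_derive_Id_sub_BA pX a0 i s Uz.
split=> //.
have s1 : (s == [:: i]) = (ap == [ffun j => (j == i : nat)]).
  apply/eqP/eqP => [si|api].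
    by apply/ffunP => j; rewrite ffunE -cnt si /= addn0 eq_sym.
  suff /perm_small_eq : perm_eq s [:: i] by apply.
  by apply/allP => j _ /=; rewrite cnt api ffunE addn0 (eq_sym i).
rewrite coefD coefC coef_sum mulrDr; congr (_ + _).
  (* As [s] is nonempty, the identity part reduces to the indicator of [[:: i]], a constant
     polynomial seen only when [a0 = 0]. *)
  rewrite -s1; case: s s_gt0 {cnt sz Hd s1} => // j s _.
  rewrite mul0r add0r; case: a0 => [|a0] /=; last by rewrite mulr0.
  by rewrite mul1r.
rewrite mulr_sumr mulr_sumr -sumrN; apply: eq_bigr => x _.
(* Positivity of the entries of [r] enters here, to cancel [r_j]. *)
have q_r j : encoder d b r j x / r ord0 j = tilt d x j (b, r).
  by rewrite (encoderE d x j (b, r)) /= mulrAC mulfV ?mul1r// gt_eqF.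
have -> : \prod_j (encoder d b r j x / r ord0 j) ^+ ap j =
    \prod_j tilt d x j (b, r) ^+ ap j.
  by apply: eq_bigr => j _; rewrite q_r.
rewrite coefCM (coef_encoder_jet _ _ _ _ _ s_gt0 cnt) sz subn1.
rewrite natrM /=; set S := \sum_(k | _) _; set P := \prod_j _ ^+ _.
by ring.
Qed.
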